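(* Let $H$ be a $3$-uniform hypergraph on $n$ vertices such that every pair of distinct vertices of $H$ is contained in at least one edge (i.e. $\delta_2(H)\geq 1$). Then at least one of the following holds: (T1) $\mathrm{mc}_3(H)\geq n-\alpha^*_3(H)$; or (T2) there exist a $3$-coloring (with colors blue, red, green) of the edges of $H$ and a partition $\{V_1,V_2,V_3,V_4\}$ of $V(H)$ into four nonempty parts with $|V_1|\geq |V_2|\geq |V_3|\geq |V_4|$ and $\alpha^*_3(H)\geq |V_2|\geq |V_3|\geq |V_4|$, and consequently $|V_1|+|V_i|\geq n-2\alpha_3^*(H)$ for all $i\in\{2,3,4\}$, such that: no edge of $H$ intersects three of the sets $V_1,V_2,V_3,V_4$; every edge which intersects both $V_1$ and $V_2$ and every edge which intersects both $V_3$ and $V_4$ is blue; every edge which intersects both $V_1$ and $V_3$ and every edge which intersects both $V_2$ and $V_4$ is red; and every edge which intersects both $V_1$ and $V_4$ and every edge which intersects both $V_2$ and $V_3$ is green. In particular, for every $3$-uniform hypergraph $H$ on $n$ vertices with $\delta_2(H)\geq 1$, we have $\mathrm{mc}_3(H)\geq n-2\alpha^*_3(H)$.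
   Context: Hypergraphs are finite with nonempty vertex set. For $\{u,v\}\in\binom{V(H)}{2}$, $d(u,v)$ is the number of edges of $H$ containing $\{u,v\}$, and $\delta_2(H)=\min\{d(u,v):\{u,v\}\in\binom{V(H)}{2}\}$. The shadow-graph $H^{(2)}$ of a hypergraph $H$ is the graph on $V(H)$ in which $\{x,y\}$ is an edge if and only if some $e\in E(H)$ satisfies $\{x,y\}\subseteq e$. $H$ is connected if $H^{(2)}$ is connected, and the components of $H$ are its maximal connected subgraphs (so an isolated vertex is a component on one vertex). An $r$-coloring of $H$ is a partition $\{E_1,\dots,E_r\}$ of $E(H)$ in which some of the sets may be empty. A monochromatic component of $H$ (with respect to this coloring) is a component of the hypergraph $(V(H),E_i)$ for some $i\in\{1,\dots,r\}$. $\mathrm{mc}_r(H)$ is the largest integer $m$ such that in every $r$-coloring of the edges of $H$ there is a monochromatic component on at least $m$ vertices. $\alpha_3^*(H)$ is the maximum integer $a$ such that there exist pairwise disjoint sets $X_1,X_2,X_3\subseteq V(H)$ with $|X_1|=|X_2|=|X_3|=a$ such that for every $e\in E(H)$ there is $i\in\{1,2,3\}$ with $e\cap X_i=\emptyset$. *)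

(* Defs.v *)
From mathcomp Require Import all_boot.

Set Implicit Arguments.
Unset Strict Implicit.
Unset Printing Implicit Defensive.

(* A hypergraph is given by a nonempty finType V of vertices and its set of
   edges E : {set {set V}}. *)

Section Hypergraph.
Variable V : finType.
Implicit Types (E : {set {set V}}) (W : {set V}).

Definition uniform (k : nat) E : Prop := forall e, e \in E -> #|e| = k.

Definition codegree E (x y : V) : nat := #|[set e in E | [set x; y] \subset e]|.

(* Every codegree is at most #|{set V}|, so the default value only matters when
   #|V| <= 1, where the minimum over the empty family gets this top value. *)
Definition delta2 E : nat :=
  \big[minn/#|{set V}|]_(p : V * V | p.1 != p.2) codegree E p.1 p.2.

Definition shadow E : rel V :=
  fun x y => (x != y) && [exists e in E, [set x; y] \subset e].

Definition induced E W : {set {set V}} := [set e in E | e \subset W].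

(* The subhypergraph of (V, E) induced on W is connected. The edges of
   [induced E W] lie inside W, so that paths starting in W stay in W. *)
Definition connected_on E W : bool :=
  (W != set0) &&
  [forall x in W, forall y in W, connect (shadow (induced E W)) x y].

(* A maximal connected subgraph is induced, hence it is identified with its
   vertex set. *)
Definition component E W : bool := maxset (connected_on E) W.

(* An r-coloring is a function on all vertex sets, of which only the values on
   E are used; the classes may be empty. *)
Definition coloring (r : nat) := {ffun {set V} -> 'I_r}.

Definition color_class r E (c : coloring r) (i : 'I_r) : {set {set V}} :=
  [set e in E | c e == i].

Definition mono_component r E (c : coloring r) W : bool :=
  [exists i, component (color_class E c i) W].

(* For r > 0 the restriction m <= #|V| is no loss, since a component has at
   most #|V| vertices. *)
Definition mc (r : nat) E : nat :=
  \max_(m < #|V|.+1 | [forall c : coloring r, exists W : {set V},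
                         mono_component E c W && (m <= #|W|)]) m.

Definition alpha3_witness E (a : nat) (X : {ffun 'I_3 -> {set V}}) : bool :=
  [&& [forall i, #|X i| == a],
      [forall i, forall j, (i != j) ==> [disjoint X i & X j]]
    & [forall e in E, exists i, [disjoint e & X i]]].

Definition alpha3 E : nat :=
  \max_(a < #|V|.+1 | [exists X, alpha3_witness E a X]) a.

Definition meets (e W : {set V}) : bool := e :&: W != set0.

End Hypergraph.

Definition blue : 'I_3 := @Ordinal 3 0 isT.
Definition red : 'I_3 := @Ordinal 3 1 isT.
Definition green : 'I_3 := @Ordinal 3 2 isT.

(* [uniq] makes the four parts distinct, which the set of parts would not. *)
Definition four_partition (V : finType) (V1 V2 V3 V4 : {set V}) : bool :=
  uniq [:: V1; V2; V3; V4] && partition [set V1; V2; V3; V4] [set: V].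

Definition joins_colored (V : finType) (E : {set {set V}}) (c : coloring V 3)
    (A B : {set V}) (i : 'I_3) : Prop :=
  forall e, e \in E -> meets e A -> meets e B -> c e = i.

(* Main.v *)
(* Label each vertex by the triple of its blue, red and green components. As
   every pair is covered, any two labels agree in some coordinate, and as every
   edge is monochromatic, its vertices agree in the coordinate of its color. If
   no coordinate is constant, such an intersecting family of triples is of one
   of two types.
   - Every label agrees with a fixed triple p in at least two coordinates. Then
     the sets X_i of vertices whose i-th label is not p_i are pairwise disjoint
     and no edge meets all three, so the smallest X_i has at most alpha3
     vertices, and its complement is a component of color i.
   - There are four labels (1,1,1), (1,2,2), (2,1,2), (2,2,1). Their classes are
     the parts of (T2): in each coordinate, only two classes share a value.
   In the second case, if V3 and V4 together were smaller than V2, then V1, V2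
   and the union of V3 and V4 would show that the component containing V1 and V2
   misses at most alpha3 vertices. *)
Require Import Defs.
From mathcomp Require Import all_boot zify.

Set Implicit Arguments.
Unset Strict Implicit.
Unset Printing Implicit Defensive.

(** * Intersecting families of label triples *)

Section IntersectingLabels.
Variables (V : finType) (T : eqType) (f : 'I_3 -> V -> T).
Hypothesis agree : forall u v, exists i, f i u = f i v.
Hypothesis nonconstant : forall i u, exists v, f i v <> f i u.

(** The triple p is encoded as [f j (w j)], one vertex per coordinate, so each of its entries is
    attained. *)
Definition majority_labels : Prop :=
  exists w : 'I_3 -> V,
    forall v, exists i, forall j, j != i -> f j v = f j (w j).

(** [s] holds one representative per label. The last clause is what later keeps an edge from meeting
    three classes. *)
Definition four_labels : Prop :=
  exists s : seq V, [/\ size s = 4, uniq s,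
    {in s &, forall u v, (forall i, f i u = f i v) -> u = v},
    (forall v, exists2 u, u \in s & forall i, f i v = f i u)
    & forall i a, count (fun u => f i u == a) s < 3].

Lemma ord3_cases (i j k : 'I_3) :
  i != j -> i != k -> j != k -> forall l, [\/ l = i, l = j | l = k].
Proof.
move=> ij ik jk l.
have [->|li] := eqVneq l i; first by constructor 1.
have [->|lj] := eqVneq l j; first by constructor 2.
constructor 3; apply/val_inj; move: ij ik jk li lj.
by case: i j k l => [[|[|[|?]]] ?] [[|[|[|?]]] ?] [[|[|[|?]]] ?] [[|[|[|?]]] ?].
Qed.

Lemma ord3_third (i j : 'I_3) : i != j -> exists2 k, i != k & j != k.
Proof.
move=> ij; have [k kP] : exists k, k \notin [set i; j].
  apply/existsP; rewrite -negb_forall; apply/negP => /forallP all_ij.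
  have /subset_leq_card : [set: 'I_3] \subset [set i; j] by apply/subsetP.
  by rewrite cardsT card_ord cards2 ij.
by exists k; move: kP; rewrite !inE negb_or ![k == _]eq_sym => /andP[].
Qed.

(** In the order [i], [j], [k] the labels are x = (a,b,c), y = (a',b',c), z = (a,b',c'). Each shares
    two entries with (a,b',c), and the only triple that agrees somewhere with all three but shares
    fewer than two is (a',b,c'). *)
Lemma labels_of_triangle (i j k : 'I_3) (x y z : V) :
    i != j -> i != k -> j != k ->
    f i x <> f i y -> f j x <> f j y -> f k x = f k y ->
    f k z <> f k x -> f i z = f i x -> f j z = f j y ->
  majority_labels \/ four_labels.
Proof.
move=> ij ik jk xyi xyj xyk zxk zxi zyj.
have cases := ord3_cases ij ik jk.
have agree3 u v : [\/ f i u = f i v, f j u = f j v | f k u = f k v].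
  case: (agree u v) => l; case: (cases l) => -> ?;
  by [constructor 1 | constructor 2 | constructor 3].
(* If (a',b,c') occurs, at [t], agreement with all four vertices leaves no fifth label. *)
have [/existsP[t /and3P[/eqP tk /eqP ti /eqP tj]] | no_t] :=
  boolP [exists t, [&& f k t == f k z, f i t == f i y & f j t == f j x]].
- right; exists [:: x; y; z; t]; split=> //.
  + rewrite /= !inE !negb_or !andbT -!andbA.
    by do ![apply/andP; split]; apply/eqP; congruence.
  + move=> u v; rewrite !inE => uP vP uv; move: (uv i) (uv j) (uv k).
    by case/or4P: uP => /eqP->; case/or4P: vP => /eqP->; congruence.
  + move=> v.
    have eqf u : f i v = f i u -> f j v = f j u -> f k v = f k u ->
        u \in [:: x; y; z; t] ->
        exists2 u, u \in [:: x; y; z; t] & forall l, f l v = f l u.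
      by move=> ? ? ? us; exists u => // l; case: (cases l) => ->.
    have [vx|vx|vx] := agree3 v x; have [vy|vy|vy] := agree3 v y;
      have [vz|vz|vz] := agree3 v z; have [vt|vt|vt] := agree3 v t;
      solve [ congruence
            | apply: (eqf x); rewrite ?inE ?eqxx ?orbT //; congruence
            | apply: (eqf y); rewrite ?inE ?eqxx ?orbT //; congruence
            | apply: (eqf z); rewrite ?inE ?eqxx ?orbT //; congruence
            | apply: (eqf t); rewrite ?inE ?eqxx ?orbT //; congruence ].
  + move=> l a /=; case: (cases l) => ->;
    by do ![case: eqP => ?]; rewrite //=; congruence.
- left; exists (fun l => if l == j then y else x) => v.
  have not_t : ~ [/\ f k v = f k z, f i v = f i y & f j v = f j x].
    move=> [vk vi vj]; move/existsP: no_t; apply.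
    by exists v; rewrite vk vi vj !eqxx.
  have maj l : (i != l -> f i v = f i x) -> (j != l -> f j v = f j y) ->
      (k != l -> f k v = f k x) ->
      exists l, forall m, m != l -> f m v = f m (if m == j then y else x).
    move=> vi vj vk; exists l => m; case: (cases m) => ->.
    + by rewrite (negPf ij).
    + by rewrite eqxx.
    + by rewrite eq_sym in jk; rewrite (negPf jk).
  (* Sharing only the first, second or third entry of (a,b',c) means disagreeing everywhere with y,
     x or z respectively; sharing none gives the excluded label. *)
  have [vi|vi] := eqVneq (f i v) (f i x);
    have [vj|vj] := eqVneq (f j v) (f j y);
    have [vk|vk] := eqVneq (f k v) (f k x).
  + by apply: (maj i).
  + by apply: (maj k) => //; rewrite eqxx.
  + by apply: (maj j) => //; rewrite eqxx.
  + exfalso; move/eqP: vj => vj; move/eqP: vk => vk.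
    by have [vy|vy|vy] := agree3 v y; congruence.
  + by apply: (maj i) => //; rewrite eqxx.
  + exfalso; move/eqP: vi => vi; move/eqP: vk => vk.
    by have [vx|vx|vx] := agree3 v x; congruence.
  + exfalso; move/eqP: vi => vi; move/eqP: vj => vj.
    by have [vz|vz|vz] := agree3 v z; congruence.
  + exfalso; move/eqP: vi => vi; move/eqP: vj => vj; move/eqP: vk => vk.
    apply: not_t; have [vx|vx|vx] := agree3 v x; have [vy|vy|vy] := agree3 v y;
      have [vz|vz|vz] := agree3 v z; by [congruence | split; congruence].
Qed.

Lemma majority_or_four_labels (x0 : V) : majority_labels \/ four_labels.
Proof.
have [x [y [i [j [ij xyi xyj]]]]] :
    exists x y i j, [/\ i != j, f i x <> f i y & f j x <> f j y].
  pose i : 'I_3 := ord0; pose j : 'I_3 := ord_max.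
  have ij : i != j by [].
  (* If neither [y] nor [z] differs from [x0] in both coordinates, they differ from each other in
     both. *)
  have [y yi] := nonconstant i x0; have [z zj] := nonconstant j x0.
  have [yj|/eqP yj] := eqVneq (f j y) (f j x0); last by exists y, x0, i, j.
  have [zi|/eqP zi] := eqVneq (f i z) (f i x0); last by exists z, x0, i, j.
  by exists y, z, i, j; split=> //; congruence.
have [k ik jk] := ord3_third ij.
have cases := ord3_cases ij ik jk.
have xyk : f k x = f k y by have [l] := agree x y; case: (cases l) => ->.
have [z zk] := nonconstant k x.
(* Neither [l] nor [m] is [k], and they are distinct since [x] and [y] differ in [i] and [j]: a
   triangle, up to swapping [i] and [j]. *)
have [l zx] := agree z x; have [m zy] := agree z y.
move: zx zy; case: (cases l) => -> zx; case: (cases m) => -> zy; try congruence.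
- exact: (labels_of_triangle ij ik jk xyi xyj xyk zk zx zy).
- by rewrite eq_sym in ij;
    exact: (labels_of_triangle ij jk ik xyj xyi xyk zk zx zy).
Qed.

End IntersectingLabels.

(** * Lower bounds for [alpha3] and [mc], and covered pairs *)

Section Hypergraphs.
Variables (V : finType) (E : {set {set V}}).

(** Larger sets can be cut down to exactly [a] vertices: subsets stay disjoint from each other and
    from the edges they avoided. *)
Lemma leq_alpha3 a (X : 'I_3 -> {set V}) :
    (forall i, a <= #|X i|) ->
    (forall i j, i != j -> [disjoint X i & X j]) ->
    (forall e, e \in E -> exists i, [disjoint e & X i]) ->
  a <= alpha3 E.
Proof.
move=> aX disjX EX.
have aV : a < #|V|.+1 by rewrite ltnS (leq_trans (aX ord0)) ?max_card.
have subX i : exists Y : {set V}, (#|Y| == a) && (Y \subset X i).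
  have /card_geqP[s [s_uniq s_size sX]] := aX i.
  exists [set:: s]; apply/andP; split.
    by rewrite cardsE (card_uniqP s_uniq) s_size.
  by apply/subsetP => v; rewrite inE; apply: sX.
pose Y := [ffun i => xchoose (subX i)].
have /all_and2[cardY YX] i : #|Y i| == a /\ Y i \subset X i.
  by apply/andP; rewrite ffunE; apply: (xchooseP (subX i)).
rewrite /alpha3 (bigmax_sup (Ordinal aV)) //.
apply/existsP; exists Y; apply/and3P; split.
- exact/forallP.
- apply/forallP => i; apply/forallP => j; apply/implyP => ij.
  exact: disjointW (YX i) (YX j) (disjX i j ij).
- apply/forallP => e; apply/implyP => eE; apply/existsP.
  by have [i eX] := EX e eE; exists i; apply: disjointWr (YX i) eX.
Qed.

Lemma leq_mc r m : m <= #|V| ->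
    (forall c : coloring V r, exists2 W, mono_component E c W & m <= #|W|) ->
  m <= mc r E.
Proof.
rewrite -ltnS => mV mP; rewrite /mc (bigmax_sup (Ordinal mV)) //.
apply/forallP => c; apply/existsP.
by have [W Wcomp Wm] := mP c; exists W; apply/andP.
Qed.

Lemma delta2_le_codegree x y : x != y -> delta2 E <= codegree E x y.
Proof.
move=> xy; rewrite /delta2.
have := mem_index_enum (x, y); elim: (index_enum _) => // p s IHs.
rewrite big_cons inE => /predU1P[<-|/IHs le_s]; first by rewrite /= xy geq_minl.
by case: ifP => // _; rewrite geq_min le_s orbT.
Qed.

Lemma pair_covered x y : 0 < delta2 E -> x != y ->
  exists2 e, e \in E & [set x; y] \subset e.
Proof.
move=> d_gt0 /delta2_le_codegree /(leq_trans d_gt0).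
by case/card_gt0P => e; rewrite inE => /andP[eE exy]; exists e.
Qed.

(** * Connected sets of the shadow graph *)

Lemma shadow_sym : symmetric (shadow E).
Proof. by move=> x y; rewrite /shadow eq_sym setUC. Qed.

Lemma connect_edge e x y : e \in E -> x \in e -> y \in e ->
  connect (shadow E) x y.
Proof.
move=> eE xe ye; have [->|xy] := eqVneq x y; first exact: connect0.
apply/connect1/andP; split=> //; apply/existsP; exists e.
by rewrite eE subUset !sub1set xe ye.
Qed.

Definition connected_set x : {set V} := [set y | connect (shadow E) x y].

Lemma connected_set_eq x y :
  (connected_set x == connected_set y) = connect (shadow E) x y.
Proof.
have csym := sym_connect_sym shadow_sym.
apply/eqP/idP => [xy|xy]; last first.
  by apply/setP=> z; rewrite !inE (same_connect csym xy).
have : y \in connected_set y by rewrite inE.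
by rewrite -xy inE.
Qed.

(** Every edge used by a path from [x] consists of vertices reachable from [x], so the path survives
    in the induced hypergraph. *)
Lemma connected_on_connected_set x : connected_on E (connected_set x).
Proof.
set K := connected_set x; have xK : x \in K by rewrite inE.
have isym : connect_sym (shadow (induced E K)).
  by apply: sym_connect_sym => u v; rewrite /shadow eq_sym setUC.
have to_x y : y \in K -> connect (shadow (induced E K)) x y.
  rewrite inE => /connectP[p xp ->] {y}.
  elim/last_ind: p xp => [|p z IHp]; first by rewrite connect0.
  rewrite rcons_path last_rcons => /andP[xp].
  case/andP => lz /existsP[e /andP[eE]].
  rewrite subUset !sub1set => /andP[le ze].
  apply: connect_trans (IHp xp) _; apply/connect1/andP; split=> //.
  apply/existsP; exists e; rewrite inE eE subUset !sub1set le ze !andbT.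
  apply/subsetP => w we; rewrite inE.
  apply: connect_trans (connect_edge eE le we).
  by apply/connectP; exists p.
apply/andP; split; first by apply/set0Pn; exists x.
apply/forallP => u; apply/implyP => /to_x xu.
apply/forallP => v; apply/implyP => /to_x xv.
by rewrite isym in xu; apply: connect_trans xu xv.
Qed.

End Hypergraphs.

(** * Component labels of a 3-coloring *)

Section Coloring.
Variables (V : finType) (E : {set {set V}}) (c : coloring V 3).
Hypothesis covered :
  forall x y : V, x != y -> exists2 e, e \in E & [set x; y] \subset e.
Hypothesis V_nonempty : 0 < #|V|.

Let K i x := connected_set (color_class E c i) x.

(** A maximal connected superset is enough for lower bounds on size, so maximality of [K i x] itself
    is left unproved. *)
Lemma mono_component_above i x :
  exists2 W, mono_component E c W & #|K i x| <= #|W|.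
Proof.
have [W Wmax KW] :=
  maxset_exists (connected_on_connected_set (color_class E c i) x).
by exists W; [apply/existsP; exists i | apply: subset_leq_card].
Qed.

Lemma mono_component_class i x :
  exists2 W, mono_component E c W & #|[set y | K i y == K i x]| <= #|W|.
Proof.
have [W WP KW] := mono_component_above i x; exists W => //.
apply: leq_trans KW; apply/subset_leq_card/subsetP => y.
by rewrite !inE eq_sym connected_set_eq.
Qed.

Lemma edge_labels e x y : e \in E -> x \in e -> y \in e ->
  K (c e) x = K (c e) y.
Proof.
move=> eE xe ye; apply/eqP; rewrite connected_set_eq.
by apply: (@connect_edge _ _ e) => //; rewrite inE eE eqxx.
Qed.

Lemma labels_agree x y : exists i, K i x = K i y.
Proof.
have [->|/covered[e eE]] := eqVneq x y; first by exists ord0.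
rewrite subUset !sub1set => /andP[xe ye].
by exists (c e); apply: edge_labels.
Qed.

Lemma component_of_majority : majority_labels K ->
  exists2 W, mono_component E c W & #|V| - alpha3 E <= #|W|.
Proof.
case=> w wP; pose X i := [set v | K i v != K i (w i)].
pose i := [arg min_(i < ord0) #|X i|].
have iP j : #|X i| <= #|X j| by rewrite /i; case: arg_minnP => // k _; apply.
have Xalpha : #|X i| <= alpha3 E.
  (* A vertex deviates from p in at most one coordinate. *)
  have off u j l : u \in X j -> u \in X l -> j = l.
    have [k kP] := wP u; rewrite !inE => uj ul.
    have -> : j = k by apply/eqP; apply: contraNT uj => /kP ->.
    by apply/esym/eqP; apply: contraNT ul => /kP ->.
  apply: (leq_alpha3 iP) => [j l jl|e eE].
    apply/pred0P => u /=; apply/negP => /andP[uj ul].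
    by rewrite (off u j l) ?eqxx in jl.
  apply/existsP; apply: contraT.
  rewrite negb_exists => /forallP meetX.
  (* The vertices of [e] share coordinate [c e], so if [e] meets [X (c e)] it lies inside it; a
     vertex of [e] in [X l] would then deviate twice. *)
  have [l lk] : exists l, l != c e.
    by case: (c e) => -[|?] ?; [exists ord_max | exists ord0].
  have /pred0Pn[u /andP[/= ue uX]] := meetX (c e).
  have /pred0Pn[v /andP[/= ve vX]] := meetX l.
  case/negP: lk; apply/eqP; apply: (off v) => //.
  by move: uX; rewrite !inE -(edge_labels eE ue ve).
have [W WP Wge] := mono_component_class i (w i); exists W => //.
apply: leq_trans Wge; rewrite -(cardsC (X i)).
have -> : ~: X i = [set y | K i y == K i (w i)].
  by apply/setP => v; rewrite !inE negbK.
lia.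
Qed.

(** All clauses are invariant under permuting [S], which allows sorting the parts by size. *)
Definition four_parts (S : seq {set V}) : Prop :=
  [/\ size S = 4, uniq S, partition [set:: S] [set: V],
      forall e, e \in E -> count (meets e) S < 3
    & {in S &, forall A B : {set V}, A != B ->
         exists2 W, mono_component E c W & #|A| + #|B| <= #|W|}].

Lemma parts_of_four_labels : four_labels K -> exists S, four_parts S.
Proof.
case=> s [s_size s_uniq s_inj s_cover s_count].
pose P u := [set v | [forall i, K i v == K i u]].
have PP u v : reflect (forall i, K i v = K i u) (v \in P u).
  rewrite inE; apply: (iffP forallP) => h i; [exact/eqP | exact/eqP].
have Pid u : u \in P u by apply/PP.
have P_disj u v : P u != P v -> [disjoint P u & P v].
  apply: contraR => /pred0Pn[w /andP[/= /PP wu /PP wv]].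
  by apply/eqP/setP => t; apply/PP/PP => h i; rewrite h -?wu ?wv // -wv wu.
exists (map P s); split.
- by rewrite size_map.
- rewrite map_inj_in_uniq // => u v us vs Puv; apply: s_inj => //.
  by apply/PP; rewrite -Puv.
- apply/and3P; split.
  + rewrite eqEsubset subsetT; apply/subsetP => v _.
    have [u us vu] := s_cover v; apply/bigcupP; exists (P u); last exact/PP.
    by rewrite inE map_f.
  + apply/trivIsetP => A B; rewrite !inE => /mapP[u _ ->] /mapP[v _ ->].
    exact: P_disj.
  + rewrite inE; apply/mapP => -[u _ /esym P0].
    by have := Pid u; rewrite P0 inE.
- move=> e eE; rewrite count_map.
  have [->|/set0Pn[x xe]] := eqVneq e set0.
    rewrite (eq_count (a2 := pred0)) ?count_pred0 // => u.
    by rewrite /= /meets set0I eqxx.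
  (* All vertices of [e] have the value of [x] in coordinate [c e], and at most two of the four
     labels have it. *)
  apply: leq_ltn_trans (s_count (c e) (K (c e) x)).
  apply: sub_count => u /set0Pn[v /setIP[ve /PP vu]].
  by rewrite -vu (edge_labels eE ve xe).
- move=> A B /mapP[u _ ->] /mapP[v _ ->] /P_disj disj.
  have [i uv] := labels_agree u v.
  have [W WP Wge] := mono_component_class i u; exists W => //.
  apply: leq_trans Wge; move: disj; rewrite -setI_eq0 => /eqP disj.
  (* Subtracting the size of the empty intersection turns the sum into the size of the union. *)
  rewrite -(subn0 (_ + _)) -(@cards0 V) -disj -cardsU.
  by apply/subset_leq_card/subsetP => w /setUP[] /PP wP; rewrite inE wP ?uv.
Qed.

Lemma large_component_or_four_parts :
  (exists2 W, mono_component E c W & #|V| - alpha3 E <= #|W|)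
  \/ exists S, four_parts S.
Proof.
have [x0 _] := card_gt0P V_nonempty.
(* A constant coordinate [i] gives a component of color [i] on all of [V]. *)
have [/existsP[i /existsP[u /forallP const]]|nonconst] :=
  boolP [exists i, exists u, forall v, K i v == K i u].
  left; have [W WP Wge] := mono_component_class i u; exists W => //.
  apply: leq_trans Wge; rewrite leq_subLR -cardsT.
  apply: leq_trans (leq_addl _ _).
  by apply/subset_leq_card/subsetP => v _; rewrite inE.
have K_nonconst i u : exists v, K i v <> K i u.
  move: nonconst; rewrite negb_exists => /forallP/(_ i).
  rewrite negb_exists => /forallP/(_ u).
  by rewrite negb_forall => /existsP[v /eqP]; exists v.
have [maj|four] := majority_or_four_labels labels_agree K_nonconst x0.
  by left; apply: component_of_majority.
by right; apply: parts_of_four_labels.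
Qed.

Lemma four_parts_perm S S' : perm_eq S S' -> four_parts S -> four_parts S'.
Proof.
move=> SS' [S_size S_uniq S_part S_count S_comp].
have memS := perm_mem SS'; split.
- by rewrite -(perm_size SS').
- by rewrite -(perm_uniq SS').
- have -> // : [set:: S'] = [set:: S] by apply/setP => A; rewrite !inE memS.
- by move=> e eE; rewrite -(permP SS') S_count.
- by move=> A B; rewrite -!memS; apply: S_comp.
Qed.

Lemma sorted_four_parts S : four_parts S ->
  exists V1 V2 V3 V4, four_parts [:: V1; V2; V3; V4] /\
    [/\ #|V2| <= #|V1|, #|V3| <= #|V2| & #|V4| <= #|V3|].
Proof.
move=> SP; pose ge (A B : {set V}) := #|B| <= #|A|.
have sortP : four_parts (sort ge S).
  by apply: four_parts_perm SP; rewrite perm_sym perm_sort.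
have ge_total : total ge by move=> A B; apply: leq_total.
move: sortP (sort_sorted ge_total S).
case: (sort ge S) => [|V1 [|V2 [|V3 [|V4 [|? ?]]]]] sortP; try by case: sortP.
by case/and4P => *; exists V1, V2, V3, V4.
Qed.

(** * Size bounds and the coloring for four sorted parts *)

Section FourParts.
Variables V1 V2 V3 V4 : {set V}.
Hypothesis parts : four_parts [:: V1; V2; V3; V4].
Hypothesis sorted12 : #|V2| <= #|V1|.

Lemma four_parts_partition : four_partition V1 V2 V3 V4.
Proof.
have [_ uniqV partV _ _] := parts; apply/andP; split=> //.
have <- // : [set:: [:: V1; V2; V3; V4]] = [set V1; V2; V3; V4].
by apply/setP => A; rewrite !inE !orbA.
Qed.

Lemma card_four_parts : #|V| = #|V1| + #|V2| + #|V3| + #|V4|.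
Proof.
have [_ uniqV partV _ _] := parts.
rewrite -cardsT (card_partition partV) (eq_bigl (mem [:: V1; V2; V3; V4])).
  by rewrite -big_uniq // !big_cons big_nil /= addn0 !addnA.
by move=> A; rewrite inE.
Qed.

(** An edge meeting each of [V1], [V2] and [V3 :|: V4] would meet three parts. [V1] is at least as
    large as [V2], hence absent from the minimum. *)
Lemma leq_alpha3_parts : minn #|V2| (#|V3| + #|V4|) <= alpha3 E.
Proof.
have [_ uniqV partV countV _] := parts.
have disjV A B : A \in [:: V1; V2; V3; V4] -> B \in [:: V1; V2; V3; V4] ->
    A != B -> A :&: B = set0.
  move=> AP BP AB; have /and3P[_ /trivIsetP triv _] := partV.
  by apply/eqP; rewrite setI_eq0; apply: triv => //; rewrite inE.
move: uniqV; rewrite /= !inE !negb_or !andbT.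
case/and3P => /and3P[n12 n13 n14] /andP[n23 n24] n34.
have d12 := disjV V1 V2; have d13 := disjV V1 V3; have d14 := disjV V1 V4.
have d23 := disjV V2 V3; have d24 := disjV V2 V4; have d34 := disjV V3 V4.
move: d12 d13 d14 d23 d24 d34; rewrite !inE !eqxx !orbT.
move=> /(_ isT isT n12) d12 /(_ isT isT n13) d13 /(_ isT isT n14) d14.
move=> /(_ isT isT n23) d23 /(_ isT isT n24) d24 /(_ isT isT n34) d34.
pose X (i : 'I_3) := nth set0 [:: V1; V2; V3 :|: V4] i.
apply: (@leq_alpha3 _ _ _ X).
- case=> -[|[|[|?]]] // ?; rewrite /X /= ?geq_min ?leqnn //.
    by rewrite sorted12.
  by rewrite cardsU d34 cards0 subn0 leqnn orbT.
- case=> -[|[|[|?]]] // ? [[|[|[|?]]] // ?] // _; rewrite /X /= -setI_eq0;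
    rewrite ?setIUr ?setIUl ?[_ :&: V1]setIC
      1?[V3 :&: V2]setIC 1?[V4 :&: V2]setIC;
    by rewrite ?d12 ?d13 ?d14 ?d23 ?d24 ?setU0 eqxx.
- move=> e eE; apply/existsP; apply: contraT.
  rewrite negb_exists => /forallP meetX.
  have := countV e eE; rewrite /=.
  have -> : meets e V1 by have := meetX ord0; rewrite -setI_eq0.
  have -> : meets e V2.
    by have := meetX (Ordinal (isT : 1 < 3)); rewrite -setI_eq0.
  have := meetX ord_max; rewrite -setI_eq0 /X /= setIUr setU_eq0 negb_and.
  by rewrite /meets; case: (_ != _); case: (_ != _).
Qed.

Lemma component_of_parts12 :
  exists2 W, mono_component E c W & #|V1| + #|V2| <= #|W|.
Proof.
have [_ uniqV _ _ comp] := parts.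
apply: comp; rewrite ?inE ?eqxx ?orbT //.
by move: uniqV; rewrite /= !inE !negb_or => /andP[/andP[]].
Qed.

(** Sorting by size may mix up the colors of [c], so edges are recolored by the pair of parts they
    meet; those meeting fewer than two parts fall to green. *)
Definition parts_coloring : coloring V 3 := [ffun e =>
  if (meets e V1 && meets e V2) || (meets e V3 && meets e V4) then blue
  else if (meets e V1 && meets e V3) || (meets e V2 && meets e V4) then red
  else green].

Lemma parts_coloring_joins :
  [/\ joins_colored E parts_coloring V1 V2 blue /\
      joins_colored E parts_coloring V3 V4 blue,
      joins_colored E parts_coloring V1 V3 red /\
      joins_colored E parts_coloring V2 V4 red
    & joins_colored E parts_coloring V1 V4 green /\
      joins_colored E parts_coloring V2 V3 green].
Proof.
have [_ _ _ countV _] := parts.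
by split; split=> e /countV; rewrite ffunE /=;
  case: (meets e V1); case: (meets e V2);
  case: (meets e V3); case: (meets e V4).
Qed.

End FourParts.
End Coloring.

(** * The general bound and the alternative between (T1) and (T2) *)

Lemma leq_mc3 (V : finType) (E : {set {set V}}) :
    (forall x y : V, x != y -> exists2 e, e \in E & [set x; y] \subset e) ->
  0 < #|V| -> #|V| - 2 * alpha3 E <= mc 3 E.
Proof.
move=> covered V_nonempty; apply: leq_mc; first exact: leq_subr.
move=> c.
have [[W WP Wge]|[S /sorted_four_parts]] :=
  large_component_or_four_parts c covered V_nonempty.
  by exists W => //; lia.
case=> V1 [V2 [V3 [V4 [parts [s12 s23 s34]]]]].
(* Either [#|V3| + #|V4|] or [#|V2|] is at most [alpha3 E]; by sorting, [V3] and [V4] together have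
   at most [2 * alpha3 E] vertices in both cases. *)
have := leq_alpha3_parts parts s12; have cardV := card_four_parts parts.
have [W WP Wge] := component_of_parts12 parts.
by exists W => //; lia.
Qed.

Theorem theorem2p3 (V : finType) (E : {set {set V}})
    (V_nonempty : 0 < #|V|) (E_uniform : uniform 3 E) :
  ((forall x y : V, x != y -> exists2 e, e \in E & [set x; y] \subset e) ->
     (#|V| - alpha3 E <= mc 3 E)
     \/
     (exists (c : coloring V 3) (V1 V2 V3 V4 : {set V}),
        four_partition V1 V2 V3 V4 /\
        (#|V1| >= #|V2| /\ #|V2| >= #|V3| /\ #|V3| >= #|V4|) /\
        alpha3 E >= #|V2| /\
        (forall W, W \in [:: V2; V3; V4] ->
           #|V1| + #|W| >= #|V| - 2 * alpha3 E) /\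
        (forall e, e \in E -> count (meets e) [:: V1; V2; V3; V4] < 3) /\
        (joins_colored E c V1 V2 blue /\ joins_colored E c V3 V4 blue) /\
        (joins_colored E c V1 V3 red /\ joins_colored E c V2 V4 red) /\
        (joins_colored E c V1 V4 green /\ joins_colored E c V2 V3 green)))
  /\
  (1 <= delta2 E -> #|V| - 2 * alpha3 E <= mc 3 E).
Proof.
(* [mc] ranges over all colorings while (T2) gives only one, so the bound comes from the dichotomy
   applied to each coloring. *)
split=> [covered|d_gt0]; last first.
  by apply: leq_mc3 => // x y; apply: pair_covered.
have [|small] := leqP (#|V| - alpha3 E) (mc 3 E); first by left.
right.
have /existsP[c /existsPn c_small] : [exists c : coloring V 3, ~~
    [exists W, mono_component E c W && (#|V| - alpha3 E <= #|W|)]].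
  apply: contraT; rewrite negb_exists => /forallP large.
  move: small; rewrite ltnNge => /negP[]; apply: leq_mc => [|c].
    exact: leq_subr.
  by have /negPn/existsP[W /andP[]] := large c; exists W.
have [[W WP Wge]|[S /sorted_four_parts]] :=
  large_component_or_four_parts c covered V_nonempty.
  by have := c_small W; rewrite WP Wge.
case=> V1 [V2 [V3 [V4 [parts [s12 s23 s34]]]]].
(* Otherwise [#|V3| + #|V4|] is at most [alpha3 E], and the component containing [V1] and [V2] is
   too large for [c]. *)
have V2_alpha : #|V2| <= alpha3 E.
  have := leq_alpha3_parts parts s12; have cardV := card_four_parts parts.
  have [W WP Wge] := component_of_parts12 parts.
  have := c_small W; rewrite WP /= -ltnNge cardV => /(leq_ltn_trans Wge); lia.
exists (parts_coloring V1 V2 V3 V4), V1, V2, V3, V4.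
have [blueP redP greenP] := parts_coloring_joins parts.
have [_ _ _ countV _] := parts.
split; first exact: four_parts_partition parts.
(* The two parts other than [V1] and [W] have at most [alpha3 E] vertices each. *)
split=> //; split=> //; split=> // W; have := card_four_parts parts.
by rewrite !inE => cardV /or3P[] /eqP->; lia.
Qed.
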